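(* Let $(L,\theta)$ be a quasigroup with holomorph $H(L,\theta)=(H,\circ)$. Then: (1) $(H,\circ^* )\equiv \big(H,(\circ_* )^*\big)\Leftrightarrow (L,\theta)\equiv (L,\theta^* )$. (2) $(H,\circ^{-1})\equiv \big(H,(\circ_{-1})^{-1}\big)\Leftrightarrow (L,\theta)\equiv (L,\theta^{-1})$. (3) $(H,{}^{-1}\circ)\equiv \big(H,{}^{-1}({}_{-1}\circ)\big)\Leftrightarrow (L,\theta)\equiv (L,{}^{-1}\theta)$. (4) $(H,(\circ^{-1})^* )\equiv \big(H,(((\circ_{-1})_* )^{-1})^*\big)\Leftrightarrow (L,\theta)\equiv (L,(\theta^{-1})^* )$. (5) $(H,({}^{-1}\circ )^* )\equiv \big(H,({}^{-1}(({}_{-1}\circ)_* ))^*\big)\Leftrightarrow (L,\theta)\equiv (L,({}^{-1}\theta )^* )$.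
   Context: A quasigroup $(L,\theta)$ is a non-empty set with a binary operation such that for all $a,b\in L$ the equations $a\,\theta\, x=b$ and $y\,\theta\, a=b$ have unique solutions $x,y\in L$. Parastrophes. For any quasigroup $(L,\theta)$ (also applied to $(H,\circ)$ and other quasigroups), the following are quasigroup operations on $L$, defined for all $x,y,z\in L$ by: $y\,\theta^*\,x=z\Leftrightarrow x\theta y=z$; $\ x\,\theta^{-1}\, z=y\Leftrightarrow x\theta y=z$; $\ z\,({}^{-1}\theta)\, y=x\Leftrightarrow x\theta y=z$; $\ z\,(\theta^{-1})^*\,x=y\Leftrightarrow x\theta y=z$; $\ y\,({}^{-1}\theta)^*\,z=x\Leftrightarrow x\theta y=z$. Holomorph. Let $Aum(L,\theta)$ be the automorphism group of $(L,\theta)$ (maps written on the right and composed left to right) and $H=Aum(L,\theta)\times L$. The holomorph $H(L,\theta)=(H,\circ)$ is the quasigroup with $(\alpha,x)\circ(\beta,y)=(\alpha\beta,\ x\beta\,\theta\, y)$. All parastrophes of $(L,\theta)$ have the same automorphism group, so their holomorphs have the same underlying set $H$. The holomorphs of the parastrophes are denoted: $H(L,\theta^* )=(H,\circ_* )$, $H(L,\theta^{-1})=(H,\circ_{-1})$, $H(L,{}^{-1}\theta)=(H,{}_{-1}\circ)$, $H(L,(\theta^{-1})^* )=(H,(\circ_{-1})_* )$, $H(L,({}^{-1}\theta)^* )=(H,({}_{-1}\circ)_* )$. For example, $(\circ_* )^*$ is the ${}^*$-parastrophe of the operation $\circ_*$; $(((\circ_{-1})_* )^{-1})^*$ is the $(\,\cdot^{-1})^*$-parastrophe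 of the operation $(\circ_{-1})_*$; and $({}^{-1}(({}_{-1}\circ)_* ))^*$ is the $({}^{-1}\cdot)^*$-parastrophe of the operation $({}_{-1}\circ)_*$. $\equiv$ denotes equivalence of two quasigroups on the same underlying set, meaning that their operations coincide (the identity map is an isomorphism). *)

(* Defs.v *)
From mathcomp Require Import all_boot.
From mathcomp Require Import boolp classical_sets.

Set Implicit Arguments.
Unset Strict Implicit.
Unset Printing Implicit Defensive.

Local Open Scope classical_set_scope.

(* A quasigroup lives on a subset L of an ambient type, so that two quasigroups
   may have the same underlying set without being given on the same type; this
   matters for the holomorphs of the parastrophes of a given quasigroup. *)
Record quasigroup (U : Type) (L : set U) := Quasigroup {
  qop :> L -> L -> L ;
  q_nonempty : L !=set0 ;
  q_solve_right : forall a b : L, exists! x : L, qop a x = b ;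
  q_solve_left : forall a b : L, exists! y : L, qop y a = b
}.

(* The underlying sets are the same and the operations coincide. *)
Definition qequiv (U : Type) (A B : set U)
    (P : quasigroup A) (Q : quasigroup B) : Prop :=
  A = B /\
  forall (a b : A) (a' b' : B), val a = val a' -> val b = val b' ->
    val (P a b) = val (Q a' b').

(* The parastrophes th^*, th^-1 and ^-1 th; the last two are obtained by unique
   choice, and their defining equivalences are the lemmas *_opE below. *)
Section Parastrophes.
Variables (U : Type) (L : set U) (th : quasigroup L).

Definition star_op (y x : L) : L := th x y.

Definition inv_op (x z : L) : L := sval (cid (q_solve_right th x z)).

Definition linv_op (z y : L) : L := sval (cid (q_solve_left th y z)).

Lemma star_opE (x y z : L) : star_op y x = z <-> th x y = z.
Proof. by []. Qed.

Lemma inv_opE (x y z : L) : inv_op x z = y <-> th x y = z.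
Proof.
rewrite /inv_op; case: cid => y' /= [yP yU]; split=> [<- //|]; exact: yU.
Qed.

Lemma linv_opE (x y z : L) : linv_op z y = x <-> th x y = z.
Proof.
rewrite /linv_op; case: cid => y' /= [yP yU]; split=> [<- //|]; exact: yU.
Qed.

Lemma star_solve_right (a b : L) : exists! x : L, star_op a x = b.
Proof. exact: q_solve_left. Qed.

Lemma star_solve_left (a b : L) : exists! y : L, star_op y a = b.
Proof. exact: q_solve_right. Qed.

Lemma inv_solve_right (a b : L) : exists! x : L, inv_op a x = b.
Proof. by exists (th a b); split=> [|x /inv_opE//]; apply/inv_opE. Qed.

Lemma inv_solve_left (a b : L) : exists! y : L, inv_op y a = b.
Proof.
have [y [yP yU]] := q_solve_left th b a.
by exists y; split=> [|x /inv_opE/yU//]; apply/inv_opE.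
Qed.

Lemma linv_solve_right (a b : L) : exists! x : L, linv_op a x = b.
Proof.
have [y [yP yU]] := q_solve_right th b a.
by exists y; split=> [|x /linv_opE/yU//]; apply/linv_opE.
Qed.

Lemma linv_solve_left (a b : L) : exists! y : L, linv_op y a = b.
Proof. by exists (th b a); split=> [|x /linv_opE//]; apply/linv_opE. Qed.

Definition qstar : quasigroup L :=
  Quasigroup (q_nonempty th) star_solve_right star_solve_left.

Definition qinv : quasigroup L :=
  Quasigroup (q_nonempty th) inv_solve_right inv_solve_left.

Definition qlinv : quasigroup L :=
  Quasigroup (q_nonempty th) linv_solve_right linv_solve_left.

End Parastrophes.

(* (th^-1)^* and (^-1 th)^*. *)
Definition qinv_star (U : Type) (L : set U) (th : quasigroup L) :=
  qstar (qinv th).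

Definition qlinv_star (U : Type) (L : set U) (th : quasigroup L) :=
  qstar (qlinv th).

Lemma qinv_starE (U : Type) (L : set U) (th : quasigroup L) (x y z : L) :
  qinv_star th z x = y <-> th x y = z.
Proof. exact: inv_opE. Qed.

Lemma qlinv_starE (U : Type) (L : set U) (th : quasigroup L) (x y z : L) :
  qlinv_star th y z = x <-> th x y = z.
Proof. exact: linv_opE. Qed.

Section Holomorph.
Variables (U : Type) (L : set U) (th : quasigroup L).

Definition Aum : set (L -> L) :=
  [set f | bijective f /\ forall x y : L, f (th x y) = th (f x) (f y)].

Lemma Aum_id : Aum id.
Proof. by split=> //; exists id. Qed.

(* Maps act on the right, so the product of f and g is "f, then g". *)
Lemma Aum_comp (f g : L -> L) : Aum f -> Aum g -> Aum (g \o f).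
Proof.
by move=> [fb fM] [gb gM]; split=> [|x y /=]; [exact: bij_comp|rewrite fM gM].
Qed.

Lemma Aum_inv (f g : L -> L) : Aum f -> cancel f g -> cancel g f -> Aum g.
Proof.
move=> [_ fM] fK gK; split; first by exists f.
by move=> x y; apply: (can_inj fK); rewrite fM !gK.
Qed.

(* The underlying set Aum(L, th) x L of the holomorph. *)
Definition holset : set ((L -> L) * L) := Aum `*` [set: L].

Definition hol_val (p q : (L -> L) * L) : (L -> L) * L :=
  (q.1 \o p.1, th (q.1 p.2) q.2).

Lemma hol_subproof (p q : holset) : hol_val (val p) (val q) \in holset.
Proof.
rewrite inE; split=> //=.
by apply: Aum_comp; [case: (set_mem (valP p)) | case: (set_mem (valP q))].
Qed.

Definition hol_op (p q : holset) : holset := SigSub (hol_subproof p q).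

Lemma hol_nonempty : holset !=set0.
Proof.
have [u uL] := q_nonempty th.
by exists (id, SigSub (mem_set uL)); split=> //; exact: Aum_id.
Qed.

Lemma hol_solve_right (a b : holset) : exists! p : holset, hol_op a p = b.
Proof.
case: a b => [[f x] fP] [[h z] hP].
have [/= fA _] := set_mem fP; have [/= hA _] := set_mem hP.
have [[g fK gK] _] := fA; have gA := Aum_inv fA fK gK.
have [y [yP yU]] := q_solve_right th (h (g x)) z.
have kP : (h \o g, y) \in holset by rewrite inE; split=> //; exact: Aum_comp.
exists (SigSub kP); split=> [|[[k t] tP] /(congr1 val) /= [E1 E2]].
  by apply: val_inj; rewrite /= /hol_val /= yP; congr pair; apply/funext => u /=; rewrite fK.
have Ek : h \o g = k by rewrite -E1; apply/funext => u /=; rewrite gK.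
apply: val_inj => /=; congr pair => //; apply: yU.
by rewrite -E2 -Ek.
Qed.

Lemma hol_solve_left (a b : holset) : exists! p : holset, hol_op p a = b.
Proof.
case: a b => [[f x] fP] [[h z] hP].
have [/= fA _] := set_mem fP; have [/= hA _] := set_mem hP.
have [[g fK gK] _] := fA; have gA := Aum_inv fA fK gK.
have [y [yP yU]] := q_solve_left th x z.
have kP : (g \o h, g y) \in holset by rewrite inE; split=> //; exact: Aum_comp.
exists (SigSub kP); split=> [|[[k t] tP] /(congr1 val) /= [E1 E2]].
  by apply: val_inj; rewrite /= /hol_val /= gK yP; congr pair; apply/funext => u /=; rewrite gK.
apply: val_inj => /=; congr pair; first by rewrite -E1; apply/funext => u /=; rewrite fK.
by rewrite (yU _ E2) fK.
Qed.

Definition holomorph : quasigroup holset :=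
  Quasigroup hol_nonempty hol_solve_right hol_solve_left.

End Holomorph.

(* Main.v *)
Require Import Defs.
From mathcomp Require Import all_boot.
From mathcomp Require Import boolp classical_sets.

(* Each of the five parastrophe operators is injective on quasigroups, since it
   can be undone by a parastrophe operator, so it can be cancelled on both sides
   of the left-hand equivalences.  What remains is that th is recovered from its
   holomorph as the operation on the pairs (id, x). *)

(** Apart from the operation, the fields are proofs, equal by proof irrelevance. *)
Lemma quasigroup_inj (U : Type) (L : set U) (P Q : quasigroup L) :
  (forall a b : L, P a b = Q a b) -> P = Q.
Proof.
case: P Q => [f f0 fr fl] [g g0 gr gl] /= fg.
have {fg} fg : f = g by apply/funext => a; apply/funext => b; exact: fg.
by case: _ / fg g0 gr gl => g0 gr gl; congr Quasigroup; exact: Prop_irrelevance.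
Qed.

Lemma qequiv_eq (U : Type) (L : set U) (P Q : quasigroup L) :
  qequiv P Q <-> P = Q.
Proof.
split=> [[_ PQ]|->]; first by apply: quasigroup_inj => a b; apply/val_inj/PQ.
by split=> // a b a' b' /val_inj -> /val_inj ->.
Qed.

Lemma qstarK (U : Type) (L : set U) : involutive (@qstar U L).
Proof. by move=> P; apply: quasigroup_inj. Qed.

Lemma qinvK (U : Type) (L : set U) : involutive (@qinv U L).
Proof.
by move=> P; apply: quasigroup_inj => a b; apply/inv_opE/inv_opE.
Qed.

Lemma qlinvK (U : Type) (L : set U) : involutive (@qlinv U L).
Proof.
by move=> P; apply: quasigroup_inj => a b; apply/linv_opE/linv_opE.
Qed.

(** [F] ranges over all carriers because the holomorphs of [th] and of a parastrophe have different
    types, even when their underlying sets are provably equal. *)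
Lemma qequiv_inj (U : Type)
    (F : forall A : set U, quasigroup A -> quasigroup A)
    (F_inj : forall A : set U, injective (F A))
    (A B : set U) (P : quasigroup A) (Q : quasigroup B) :
  qequiv (F A P) (F B Q) <-> qequiv P Q.
Proof.
(* Eliminating [A = B] puts both operations on one carrier, where equivalence is equality. *)
split=> -[AB]; case: _ / AB Q => Q PQ; apply/qequiv_eq.
  by apply/F_inj/qequiv_eq.
by congr F; apply/qequiv_eq.
Qed.

Lemma qequiv_holomorph (U : Type) (L : set U) (P Q : quasigroup L) :
  qequiv (holomorph P) (holomorph Q) <-> qequiv P Q.
Proof.
split=> [[_ PQ]|/qequiv_eq ->]; last exact/qequiv_eq.
have idP (R : quasigroup L) (x : L) : (id, x) \in holset R.
  by rewrite inE; split=> //; exact: Aum_id.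
apply/qequiv_eq/quasigroup_inj => a b.
(* The product of [(id, a)] and [(id, b)] has second component [P a b], respectively [Q a b]. *)
by have [] := PQ (SigSub (idP P a)) (SigSub (idP P b))
                 (SigSub (idP Q a)) (SigSub (idP Q b)) erefl erefl.
Qed.

Theorem theorem3p3 (U : Type) (L : set U) (th : quasigroup L) :
  [/\ qequiv (qstar (holomorph th)) (qstar (holomorph (qstar th)))
        <-> qequiv th (qstar th),
      qequiv (qinv (holomorph th)) (qinv (holomorph (qinv th)))
        <-> qequiv th (qinv th),
      qequiv (qlinv (holomorph th)) (qlinv (holomorph (qlinv th)))
        <-> qequiv th (qlinv th),
      qequiv (qinv_star (holomorph th)) (qinv_star (holomorph (qinv_star th)))
        <-> qequiv th (qinv_star th)
    & qequiv (qlinv_star (holomorph th)) (qlinv_star (holomorph (qlinv_star th)))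
        <-> qequiv th (qlinv_star th)].
Proof.
have star_inj (V : Type) (A : set V) := can_inj (@qstarK V A).
have inv_inj (V : Type) (A : set V) := can_inj (@qinvK V A).
have linv_inj (V : Type) (A : set V) := can_inj (@qlinvK V A).
(* Only the outer parastrophe is left to cancel; for the composite ones, first the star, then the
   inner inverse. *)
split; apply: iff_trans (qequiv_holomorph _ _ _ _).
- exact: (@qequiv_inj _ (@qstar _)).
- exact: (@qequiv_inj _ (@qinv _)).
- exact: (@qequiv_inj _ (@qlinv _)).
- by apply: (@qequiv_inj _ (@qinv_star _)) => A P Q /star_inj/inv_inj.
- by apply: (@qequiv_inj _ (@qlinv_star _)) => A P Q /star_inj/linv_inj.
Qed.
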